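(* Let $M_-,M_+\in\mathbb{Z}$ and let $K_{\rm s}\geq1$ be an integer with $$M:=M_-+M_+\geq2,\qquad -M_-\leq0<1\leq M_+,\qquad 1\leq K_{\rm s}\leq\min(M_-+1,M_+)$$ (so that each substencil $\{i-M_-+k_{\rm s},\dots,i+M_+-K_{\rm s}+k_{\rm s}\}$, $k_{\rm s}\in\{0,\dots,K_{\rm s}\}$, contains $i$ or $i+1$). Define $$I_{C_{R_1}(\frac12),M_-,M_+,K_{\rm s}}:=\bigcap_{L_{\rm s}=0}^{K_{\rm s}-1}\;\bigcap_{\ell_{\rm s}=0}^{L_{\rm s}}I_{C_{R_1}(\frac12),M_--\ell_{\rm s},M_+-L_{\rm s}+\ell_{\rm s},1}.$$ Then the rational weight-functions satisfy $$0<\sigma_{R_1,M_-,M_+,K_{\rm s},k_{\rm s}}(\xi)<1\qquad\forall\,\xi\in I_{C_{R_1}(\frac12),M_-,M_+,K_{\rm s}},\quad\forall\,k_{\rm s}\in\{0,\dots,K_{\rm s}\},$$ so that for these $\xi$ the combination $$p_{R_1,M_-,M_+}(x_i+\xi\Delta x;x_i,\Delta x;f)=\sum_{k_{\rm s}=0}^{K_{\rm s}}\sigma_{R_1,M_-,M_+,K_{\rm s},k_{\rm s}}(\xi)\;p_{R_1,M_--k_{\rm s},M_+-K_{\rm s}+k_{\rm s}}(x_i+\xi\Delta x;x_i,\Delta x;f)$$ ($x_i\in\mathbb{R}$, $\Delta x>0$, $f:\mathbb{R}\to\mathbb{R}$) is convex.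
   Context: For integers $N_\pm$ (of either sign) with $N:=N_-+N_+\ge0$ and $\ell\in\{-N_-,\dots,N_+\}$, put $$\alpha_{I,N_-,N_+,\ell}(\xi)=\prod_{k=-N_-,\,k\neq\ell}^{N_+}\frac{\xi-k}{\ell-k}=\sum_{m=0}^{N}a^{N_-,N_+}_{m,\ell}\,\xi^m ,$$ which defines the coefficients $a^{N_-,N_+}_{m,\ell}$. The fundamental polynomials of Lagrange reconstruction are $$\alpha_{R_1,N_-,N_+,\ell}(\xi):=\sum_{m=0}^{N}\Bigl(\sum_{k=0}^{\lfloor (N-m)/2\rfloor}\frac{\tau_{2k}\,(m+2k)!}{m!}\,a^{N_-,N_+}_{m+2k,\ell}\Bigr)\xi^m ,$$ where $\tau_0=1$ and $\tau_{2k}=-\sum_{s=0}^{k-1}\dfrac{\tau_{2s}}{2^{2k-2s}(2k-2s+1)!}$ for $k\geq1$. The polynomial $\alpha_{R_1,N_-,N_+,\ell}$ has degree $N$ and $N$ distinct real roots $\xi_{R_1,N_-,N_+,\ell,n}$, $n\in\{-N_-,\dots,N_+\}\setminus\{\ell\}$, where $\xi_{R_1,N_-,N_+,\ell,n}$ is the unique root in $(n-\frac12,n+\frac12)$. The Lagrange reconstructing polynomial of $f$ on the points $x_i+\ell\Delta x$, $\ell\in\{-N_-,\dots,N_+\}$, is $p_{R_1,N_-,N_+}(x_i+\xi\Delta x;x_i,\Delta x;f)=\sum_{\ell=-N_-}^{N_+}\alpha_{R_1,N_-,N_+,\ell}(\xi)\,f(x_i+\ell\Delta x)$. The weight-functions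 are the rational functions defined recursively, for integers $N_\pm$ with $N:=N_-+N_+\ge2$, $K\in\{1,\dots,N-1\}$ and $k\in\{0,\dots,K\}$, by $$\sigma_{R_1,N_-,N_+,1,k}(\xi)=\dfrac{\alpha_{R_1,N_-,N_+,-N_-+kN}(\xi)}{\alpha_{R_1,N_--k,N_+-1+k,-N_-+kN}(\xi)},$$ and, for $K\geq2$, $$\sigma_{R_1,N_-,N_+,K,k}(\xi)=\sum_{\ell_{\rm s}=\max(0,k-1)}^{\min(K-1,k)}\sigma_{R_1,N_-,N_+,K-1,\ell_{\rm s}}(\xi)\;\sigma_{R_1,N_--\ell_{\rm s},N_+-(K-1)+\ell_{\rm s},1,k-\ell_{\rm s}}(\xi).$$ They satisfy $\sum_{k=0}^{K}\sigma_{R_1,N_-,N_+,K,k}(\xi)=1$. For integers $N_-\ge0$, $N_+\geq1$ with $N_-+N_+\geq2$, the $1$-level convexity interval around $\frac12$ is the open interval $I_{C_{R_1}(\frac12),N_-,N_+,1}:=(\xi^-,\xi^+)\ni\frac12$ with $$\xi^-:=\begin{cases}\xi_{R_1,N_-,N_+,N_+,0}&N_-=0\\ \max\left(\xi_{R_1,N_-,N_+,N_+,0},\,\xi_{R_1,N_-,N_+,-N_-,0},\,\xi_{R_1,N_-,N_+-1,-N_-,0}\right)&N_->0\end{cases}$$ $$\xi^+:=\begin{cases}\xi_{R_1,N_-,N_+,-N_-,1}&N_+=1\\ \min\left(\xi_{R_1,N_-,N_+,-N_-,1},\,\xi_{R_1,N_-,N_+,N_+,1},\,\xi_{R_1,N_--1,N_+,N_+,1}\right)&N_+>1.\end{cases}$$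 ''Convex'' means that the weights lie in $[0,1]$ and sum to $1$. *)

(* Defs.v *)
From HB Require Import structures.
From mathcomp Require Import all_boot all_order all_algebra.
From mathcomp Require Import all_classical all_reals.

Set Implicit Arguments.
Unset Strict Implicit.
Unset Printing Implicit Defensive.

Import Order.TTheory GRing.Theory Num.Theory.

Local Open Scope ring_scope.
Local Open Scope classical_set_scope.

(* The integers -Nm, ..., Np in increasing order; Nm and Np may be of either
   sign, and the list is empty when Nm + Np < 0. *)
Definition stencil (Nm Np : int) : seq int :=
  if Nm + Np is Posz N then [seq i%:Z - Nm | i <- iota 0 N.+1] else [::].

Lemma mem_stencil (Nm Np l : int) :
  (l \in stencil Nm Np) = (- Nm <= l <= Np).
Proof.
rewrite /stencil; case E: (Nm + Np) => [N|N].
- have NpE : Np = N%:Z - Nm by rewrite -E addrAC subrr add0r.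
  apply/mapP/idP => [[i]|].
  + rewrite mem_iota add0n ltnS /= => iN ->.
    by rewrite NpE lerD2r lez_nat iN andbT addrC lerDl.
  + move=> /andP[l1 l2]; exists (absz (l + Nm)).
    * rewrite mem_iota add0n ltnS /= -lez_nat gez0_abs ?lerBlDr ?sub0r.
        by rewrite -lerBrDr -NpE.
      by rewrite -lerBlDr sub0r.
    * by rewrite gez0_abs ?addrK // -lerBlDr sub0r.
- rewrite in_nil; apply/esym/negbTE/negP => /andP[l1 l2].
  have : 0 <= Nm + Np by rewrite -lerBlDl sub0r (le_trans l1).
  by rewrite E.
Qed.

Lemma stencil_uniq (Nm Np : int) : uniq (stencil Nm Np).
Proof.
rewrite /stencil; case: (Nm + Np) => // N.
by rewrite map_inj_uniq ?iota_uniq // => i j /addIr [].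
Qed.

Section Reconstruction.
Variable R : realType.

(* Course-of-values recursion: tau_prefix k = [:: tau_0; tau_2; ...; tau_{2k}].
   The intended recurrence is tau2_0, tau2_rec below. *)
Fixpoint tau_prefix (k : nat) : seq R :=
  if k is k'.+1 then
    let t := tau_prefix k' in
    rcons t (- \sum_(s < k'.+1)
      t`_s / (2 ^+ (2 * k'.+1 - 2 * s) * ((2 * k'.+1 - 2 * s + 1)`!)%:R))
  else [:: 1].

Definition tau2 (k : nat) : R := (tau_prefix k)`_k.

Lemma size_tau_prefix (k : nat) : size (tau_prefix k) = k.+1.
Proof. by elim: k => //= k IH; rewrite size_rcons IH. Qed.

Lemma nth_tau_prefix (k s : nat) : (s <= k)%N -> (tau_prefix k)`_s = tau2 s.
Proof.
elim: k => [|k IH]; first by rewrite leqn0 => /eqP ->.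
rewrite leq_eqVlt => /predU1P[-> //|]; rewrite ltnS => sk.
by rewrite /= nth_rcons size_tau_prefix ltnS sk IH.
Qed.

Lemma tau2_0 : tau2 0 = 1.
Proof. by []. Qed.

Lemma tau2_rec (k : nat) : (1 <= k)%N ->
  tau2 k = - \sum_(s < k)
    tau2 s / (2 ^+ (2 * k - 2 * s) * ((2 * k - 2 * s + 1)`!)%:R).
Proof.
case: k => // k _; rewrite {1}/tau2 [tau_prefix _]/=.
rewrite nth_rcons size_tau_prefix ltnn eqxx.
by congr (- _); apply: eq_bigr => s _; rewrite nth_tau_prefix // -ltnS.
Qed.

Definition alphaI (Nm Np l : int) : {poly R} :=
  \prod_(k <- stencil Nm Np | k != l)
    (((l - k)%:~R)^-1 *: ('X - (k%:~R)%:P)).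

(* Meaningful for 0 <= Nm + Np. *)
Definition alphaR (Nm Np l : int) : {poly R} :=
  let N := absz (Nm + Np) in
  \poly_(m < N.+1)
    \sum_(k < ((N - m)./2).+1)
      tau2 k * ((m + 2 * k)`!)%:R / (m`!)%:R * (alphaI Nm Np l)`_(m + 2 * k).

(* The root of alphaR Nm Np l in (n - 1/2, n + 1/2), meaningful for
   n in the stencil other than l (0 if there is no such root). *)
Definition xiR (Nm Np l n : int) : R :=
  xget 0 [set x : R | n%:~R - 2^-1 < x < n%:~R + 2^-1 /\
                      root (alphaR Nm Np l) x].

(* p_{R_1,Nm,Np}(x; xi, dx; f) as a function of x. *)
Definition pR (Nm Np : int) (x xi dx : R) (f : R -> R) : R :=
  \sum_(l <- stencil Nm Np)
    (alphaR Nm Np l).[(x - xi) / dx] * f (xi + l%:~R * dx).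

Lemma pR_xi (Nm Np : int) (xi dx : R) (f : R -> R) (t : R) : 0 < dx ->
  pR Nm Np (xi + t * dx) xi dx f =
  \sum_(l <- stencil Nm Np) (alphaR Nm Np l).[t] * f (xi + l%:~R * dx).
Proof.
by move=> dx0; rewrite /pR addrAC subrr add0r mulfK // gt_eqF.
Qed.

(* Rational functions are evaluated as pointwise quotients.  At a zero of the
   denominator the value is 0, so 0 < sigma1 implies that t is not a pole. *)
Definition sigma1 (Nm Np : int) (k : nat) (t : R) : R :=
  let l := - Nm + k%:Z * (Nm + Np) in
  (alphaR Nm Np l).[t] / (alphaR (Nm - k%:Z) (Np - 1 + k%:Z) l).[t].

(* Meaningful for 1 <= K; max(0, k - 1) is the truncated predecessor k.-1. *)
Fixpoint sigma (Nm Np : int) (K k : nat) (t : R) {struct K} : R :=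
  match K with
  | 0 => 0
  | K'.+1 =>
    match K' with
    | 0 => sigma1 Nm Np k t
    | _ => \sum_(k.-1 <= s < (minn K' k).+1)
             sigma Nm Np K' s t *
             sigma1 (Nm - s%:Z) (Np - K'%:Z + s%:Z) (k - s) t
    end
  end.

Lemma sigma_1 (Nm Np : int) (k : nat) (t : R) :
  sigma Nm Np 1 k t = sigma1 Nm Np k t.
Proof. by []. Qed.

Lemma sigma_rec (Nm Np : int) (K k : nat) (t : R) : (2 <= K)%N ->
  sigma Nm Np K k t =
  \sum_(maxn 0 (k - 1) <= s < (minn (K - 1) k).+1)
    sigma Nm Np (K - 1) s t *
    sigma (Nm - s%:Z) (Np - (K - 1)%N%:Z + s%:Z) 1 (k - s) t.
Proof. by case: K => [|[|K]] // _; rewrite max0n !subn1. Qed.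

(* The one-level convexity interval around 1/2, meaningful for
   0 <= Nm, 1 <= Np and 2 <= Nm + Np. *)
Definition xi_minus (Nm Np : int) : R :=
  if Nm == 0 then xiR Nm Np Np 0
  else Num.max (xiR Nm Np Np 0)
         (Num.max (xiR Nm Np (- Nm) 0) (xiR Nm (Np - 1) (- Nm) 0)).

Definition xi_plus (Nm Np : int) : R :=
  if Np == 1 then xiR Nm Np (- Nm) 1
  else Num.min (xiR Nm Np (- Nm) 1)
         (Num.min (xiR Nm Np Np 1) (xiR (Nm - 1) Np Np 1)).

Definition IC1 (Nm Np : int) : set R := `]xi_minus Nm Np, xi_plus Nm Np[.

Definition IC (Mm Mp : int) (K : nat) : set R :=
  \bigcap_(L < K) \bigcap_(l < L.+1) IC1 (Mm - l%:Z) (Mp - L%:Z + l%:Z).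

Definition convex_weights (K : nat) (w : nat -> R) : Prop :=
  (forall k, (k <= K)%N -> 0 <= w k <= 1) /\ \sum_(k < K.+1) w k = 1.

End Reconstruction.

(* Main.v *)
(* A primitive of alphaR l takes at the half-integer knots the values of a step
   function jumping at l.  When l is an end of the stencil it is therefore, up
   to a constant, the product eta of the X - knot over the interior knots times
   the linear factor of one end knot; for the two substencils it is eta itself.
   With N + 2 knots, x_first and x_last the end ones, this gives
     sigma_0 = ((x_last - t) eta' - eta) / ((N + 1) eta'),
     sigma_1 = ((t - x_first) eta' + eta) / ((N + 1) eta'),
   so sigma_0 + sigma_1 = 1, and the combination identity reduces to Neville's
   relation between the Lagrange polynomials of nested stencils.  Between two
   knots logarithmic derivatives decrease strictly, so on either side of the
   knot 1/2 the bounds xi^- and xi^+ fix the signs of those of eta and of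
   its products with an end factor, which makes both weights positive.  Higher levels follow
   by induction, since each step splits every weight by one-level weights. *)

Require Import Defs.
From HB Require Import structures.
From mathcomp Require Import all_boot all_order all_algebra.
From mathcomp Require Import all_classical all_reals.
From mathcomp Require Import zify ring lra.
From mathcomp Require Import polyrcf.

Set Implicit Arguments.
Unset Strict Implicit.
Unset Printing Implicit Defensive.

Import Order.TTheory GRing.Theory Num.Theory.

Local Open Scope ring_scope.
Local Open Scope classical_set_scope.

(** * Sliding averages of polynomials and their inverse *)

(** Used for the Cauchy product of two truncated series: what the square contains beyond the
    triangle vanishes. *)
Lemma big_square_antidiag (V : zmodType) (B : nat) (F : nat -> nat -> V) :
  (forall i j, (B <= i + j)%N -> F i j = 0) ->
  \sum_(i < B) \sum_(j < B) F i j =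
  \sum_(n < B) \sum_(i < n.+1) F i (n - i)%N.
Proof.
move=> F0.
transitivity (\sum_(0 <= i < B) \sum_(0 <= n < B | (i <= n)%N) F i (n - i)%N).
  rewrite big_mkord; apply: eq_bigr => i _.
  rewrite -(big_mkord xpredT (F i)) (big_cat_nat (n := (B - i)%N)) ?leq_subr //=.
  rewrite [X in _ + X]big_nat_cond [X in _ + X]big1 ?addr0; last first.
    by move=> j /andP[/andP[jB _] _]; apply: F0; rewrite -leq_subLR.
  rewrite [RHS](big_cat_nat (n := i)) //=; last exact: ltnW.
  rewrite [X in X + _]big_nat_cond [X in X + _]big1 ?add0r; last first.
    by move=> j /andP[/andP[_ ji] ij]; rewrite leqNgt ji in ij.
  rewrite -[X in _ = \sum_(X <= _ < _ | _) _]add0n big_addn.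
  by apply: eq_big => j; rewrite ?leq_addl // addnK.
rewrite (exchange_big_dep_nat xpredT) //= big_mkord; apply: eq_bigr => n _.
rewrite -(big_mkord xpredT (fun i => F i (n - i)%N)) (big_nat_widen 0%N n.+1 B) //=.
Qed.

Section Reconstruction.
Variable R : realType.
Implicit Types (p q Q : {poly R}) (Nm Np l a : int) (t : R).

(** With $D$ the derivation, averaging over a unit interval is $2\sinh(D/2)/D$; this is its
    coefficient at $D^{2j}$. *)
Definition avg_coef (j : nat) : R := (2 ^+ (2 * j) * ((2 * j + 1)`!)%:R)^-1.

(** The recurrence for $\tau$ makes its generating series the reciprocal of that of [avg_coef]. *)
Lemma tau2_avg_coef n :
  \sum_(s < n.+1) tau2 R s * avg_coef (n - s) = (n == 0%N)%:R.
Proof.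
case: n => [|n]; first by rewrite big_ord1 tau2_0 /avg_coef expr0 !mul1r invr1.
rewrite big_ord_recr subnn /= {2}/avg_coef expr0 mul1r invr1 mulr1.
rewrite tau2_rec //; apply/eqP; rewrite subr_eq0; apply/eqP.
by apply: eq_bigr => s _; rewrite /avg_coef mulnBr.
Qed.

(* On polynomials of size at most 2B, [avg B] maps q to its sliding average
   over [x - 1/2, x + 1/2], and [deconv B] is the inverse operator. *)
Definition avg (B : nat) q : {poly R} := \sum_(k < B) avg_coef k *: q^`(2 * k).
Definition deconv (B : nat) q : {poly R} := \sum_(k < B) tau2 R k *: q^`(2 * k).

Lemma deconvD B p q : deconv B (p + q) = deconv B p + deconv B q.
Proof.
by rewrite /deconv -big_split; apply: eq_bigr => k _; rewrite derivnD scalerDr.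
Qed.

Lemma deconvZ B c p : deconv B (c *: p) = c *: deconv B p.
Proof.
rewrite /deconv scaler_sumr; apply: eq_bigr => k _.
by rewrite derivnZ !scalerA mulrC.
Qed.

Lemma size_derivn_leq n p : (size p^`(n) <= size p)%N.
Proof.
elim: n => // n IH; rewrite derivnS; apply: leq_trans IH.
have [->|?] := eqVneq p^`(n) 0; first by rewrite deriv0.
exact/ltnW/lt_size_deriv.
Qed.

Lemma size_avg B p : (size (avg B p) <= size p)%N.
Proof.
apply: (leq_trans (size_sum _ _ _)); apply/bigmax_leqP => k _.
exact: leq_trans (size_scale_leq _ _) (size_derivn_leq _ _).
Qed.

Lemma derivnDn m n p : p^`(m)^`(n) = p^`(m + n).
Proof. by rewrite /derivn addnC iterD. Qed.

(** Grouped by total order of derivation, the composite has the coefficients of the product of two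
    reciprocal series; derivatives of order at least $2B$ kill [p]. *)
Lemma avgK B p : (size p <= 2 * B)%N -> deconv B (avg B p) = p.
Proof.
move=> sB.
transitivity (\sum_(i < B) \sum_(j < B)
    (tau2 R i * avg_coef j) *: p^`(2 * (i + j))).
  apply: eq_bigr => i _; rewrite /avg linear_sum scaler_sumr.
  apply: eq_bigr => j _.
  by rewrite /= derivnZ scalerA derivnDn addnC mulnDr.
rewrite (big_square_antidiag (F := fun i j => (tau2 R i * avg_coef j) *: p^`(2 * (i + j)))); last first.
  move=> i j Bij; rewrite derivn_poly0 ?scaler0 //.
  by rewrite (leq_trans sB) // leq_mul2l.
under eq_bigr => n _.
  rewrite (eq_bigr (fun i : 'I_n.+1 => (tau2 R i * avg_coef (n - i)) *: p^`(2 * n))).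
    rewrite -scaler_suml tau2_avg_coef; over.
  by move=> i _; rewrite subnKC // -ltnS.
case: B sB => [|B sB].
  by rewrite muln0 leqn0 size_poly_eq0 => /eqP ->; rewrite big_ord0.
by rewrite big_ord_recl /= scale1r big1 ?addr0 // => i _; rewrite scale0r.
Qed.

(** The mean of a derivative is an increment of its primitive. In the Taylor expansions at [t], even
    orders cancel and odd orders give the average. *)
Lemma horner_avg B Q t : (size Q <= 2 * B)%N ->
  (avg B Q^`()).[t] = Q.[t + 2^-1] - Q.[t - 2^-1].
Proof.
move=> sB.
rewrite !(@nderiv_taylor_wide _ (2 * B) Q) //; try exact: mulrC.
rewrite -sumrB /avg horner_sum.
have -> : \sum_(i < 2 * B) (Q^`N(i).[t] * 2^-1 ^+ i - Q^`N(i).[t] * (- 2^-1) ^+ i)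
  = \sum_(k < B) (Q^`N(2 * k).[t] * 2^-1 ^+ (2 * k) - Q^`N(2 * k).[t] * (- 2^-1) ^+ (2 * k))
  + \sum_(k < B) (Q^`N((2 * k).+1).[t] * 2^-1 ^+ (2 * k).+1 - Q^`N((2 * k).+1).[t] * (- 2^-1) ^+ (2 * k).+1).
  elim: B {sB} => [|B IH]; first by rewrite muln0 !big_ord0 addr0.
  by rewrite mulnS add2n !big_ord_recr IH /=; ring.
rewrite [X in _ = X + _]big1 ?add0r; last by move=> k _; rewrite !exprM sqrrN subrr.
apply: eq_bigr => k _.
rewrite hornerZ -derivSn nderivn_def hornerMn exprS [in X in _ = _ - X]exprS.
rewrite !(exprM (2 ^-1)) !(exprM (- 2 ^-1)) sqrrN /avg_coef addn1 -exprM exprVn.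
rewrite -[_ *+ _`!]mulr_natr.
have f0 : ((2 * k).+1`!)%:R != 0 :> R by rewrite pnatr_eq0 -lt0n fact_gt0.
have p0 : 2 ^+ (2 * k) != 0 :> R by rewrite expf_neq0 // pnatr_eq0.
by field; rewrite f0 p0.
Qed.

(** * Interpolation on a stencil, and reconstruction as deconvolution *)

Lemma size_stencil Nm Np : 0 <= Nm + Np ->
  size (stencil Nm Np) = (absz (Nm + Np)).+1.
Proof. by rewrite /stencil; case: (Nm + Np) => // N _; rewrite size_map size_iota. Qed.

Lemma stencil_interpolation Nm Np p q :
  (size p <= size (stencil Nm Np))%N -> (size q <= size (stencil Nm Np))%N ->
  (forall k, k \in stencil Nm Np -> p.[k%:~R] = q.[k%:~R]) -> p = q.
Proof.
move=> sp sq pq; apply/eqP; rewrite -subr_eq0; apply/eqP.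
apply: (@roots_geq_poly_eq0 _ _ [seq k%:~R | k <- stencil Nm Np]).
- by apply/allP => _ /mapP[k ks ->]; rewrite rootE !hornerE pq // subrr.
- by rewrite map_inj_uniq ?stencil_uniq //; exact: intr_inj.
- by rewrite size_map (leq_trans (size_polyD _ _)) // size_polyN geq_max sp.
Qed.

Lemma size_alphaI Nm Np l : l \in stencil Nm Np ->
  (size (alphaI R Nm Np l) <= size (stencil Nm Np))%N.
Proof.
move=> ls; rewrite /alphaI -big_filter -(prednK (n := size (stencil Nm Np))); last by case: stencil ls.
rewrite -(size_rem ls) rem_filter ?stencil_uniq //.
elim: [seq _ <- _ | _] => [|k s IH]; first by rewrite big_nil size_poly1.
rewrite big_cons (leq_trans (size_polyMleq _ _)) //= -subn1 leq_subLR add1n.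
by rewrite -[X in (_ <= X)%N]add2n leq_add // (leq_trans (size_scale_leq _ _)) // size_XsubC.
Qed.

Lemma alphaI_node Nm Np l k : k \in stencil Nm Np ->
  (alphaI R Nm Np l).[k%:~R] = (k == l)%:R.
Proof.
move=> ks; rewrite /alphaI horner_prod; case: eqVneq => [->|kl].
  apply: big1_seq => j /andP[jl _]; rewrite !hornerE intrB mulVf // -intrB.
  by rewrite intr_eq0 subr_eq0 eq_sym.
by rewrite (big_rem k) //= kl !hornerE subrr mulr0 mul0r.
Qed.

(** The factor $(m+2k)!/m!$ comes from differentiating $2k$ times; the limits on $m$ and $k$ in
    [alphaR] cut off only coefficients of [alphaI] beyond its degree bound $N$. *)
Lemma alphaR_deconv Nm Np l B : l \in stencil Nm Np ->
  (size (stencil Nm Np) <= 2 * B)%N ->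
  alphaR R Nm Np l = deconv B (alphaI R Nm Np l).
Proof.
move=> ls sB; have N0 : 0 <= Nm + Np by move: ls; rewrite mem_stencil; lia.
have sa := size_alphaI ls.
move: sB sa; rewrite size_stencil // /alphaR; set N := absz _.
set P := alphaI _ _ _ _ => NB sP.
apply/polyP => m; rewrite coef_poly coef_sum.
under eq_bigr => k _.
  rewrite (_ : tau2 R k * _ / _ * _ = (tau2 R k *: P^`(2 * k))`_m); first over.
  rewrite coefZ coef_derivn -[X in _ = _ * X]mulr_natr -!mulrA; congr (_ * _).
  rewrite [(2 * k + m)%N]addnC mulrA [RHS]mulrC; congr (_ * _).
  rewrite -(ffact_fact (leq_addl m (2 * k))) addnK natrM mulfK //.
  by rewrite pnatr_eq0 -lt0n fact_gt0.
case: ltnP => mN; last first.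
  rewrite big1 // => k _; rewrite coefZ coef_derivn nth_default ?mul0rn ?mulr0 //.
  by rewrite (leq_trans sP) // (leq_trans mN) // leq_addl.
rewrite (big_ord_widen B (fun k => (tau2 R k *: P^`(2 * k))`_m)); last by lia.
rewrite big_mkcond; apply: eq_bigr => k _; case: ifP => // kN.
rewrite coefZ coef_derivn nth_default ?mul0rn ?mulr0 //.
by apply: leq_trans sP _; lia.
Qed.

(** The average of $Q'$ agrees with [c *: alphaI] at every node, hence as a polynomial by the size
    bounds; deconvolving both gives the claim. *)
Lemma deriv_step_alphaR Nm Np l c Q : l \in stencil Nm Np ->
  (size Q <= (size (stencil Nm Np)).+1)%N ->
  (forall k, k \in stencil Nm Np ->
     Q.[k%:~R + 2^-1] - Q.[k%:~R - 2^-1] = c * (k == l)%:R) ->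
  Q^`() = c *: alphaR R Nm Np l.
Proof.
move=> ls sQ Qs; pose B := (size (stencil Nm Np)).+1.
have sQ' : (size Q^`() <= size (stencil Nm Np))%N.
  have [->|Q0] := eqVneq Q 0; first by rewrite deriv0 size_poly0.
  by rewrite -ltnS (leq_trans (lt_size_deriv Q0)).
rewrite (@alphaR_deconv _ _ _ B) //; last by lia.
rewrite -deconvZ -[LHS](@avgK B); last by lia.
congr deconv; apply: (@stencil_interpolation Nm Np).
- exact: leq_trans (size_avg _ _) _.
- exact: leq_trans (size_scale_leq _ _) (size_alphaI ls).
- move=> k ks; rewrite horner_avg; last by lia.
  by rewrite hornerZ alphaI_node // Qs.
Qed.

(** * Half-integer knots and primitives of the end polynomials *)

Definition knot (k : int) : R := k%:~R - 2^-1.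

Lemma ltr_knot k1 k2 : (knot k1 < knot k2) = (k1 < k2).
Proof. by rewrite ltrD2r ltr_int. Qed.

Lemma ler_knot k1 k2 : (knot k1 <= knot k2) = (k1 <= k2).
Proof. by rewrite lerD2r ler_int. Qed.

Lemma eqr_knot k1 k2 : (knot k1 == knot k2) = (k1 == k2).
Proof. by rewrite (inj_eq (addIr _)) eqr_int. Qed.

Lemma knotS k : knot (k + 1) = k%:~R + 2^-1.
Proof. by rewrite /knot intrD; lra. Qed.

Definition omega a (n : nat) : {poly R} :=
  \prod_(i < n) ('X - (knot (a + (i : nat)%:Z))%:P).

Lemma omegaSr a n : omega a n.+1 = omega a n * ('X - (knot (a + n%:Z))%:P).
Proof. by rewrite /omega big_ord_recr. Qed.

Lemma omegaSl a n : omega a n.+1 = ('X - (knot a)%:P) * omega (a + 1) n.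
Proof.
rewrite /omega big_ord_recl addr0; congr (_ * _); apply: eq_bigr => i _.
by rewrite lift0 -addrA -intS.
Qed.

Lemma size_omega a n : size (omega a n) = n.+1.
Proof. by rewrite size_prod_XsubC /index_enum -enumT size_enum_ord. Qed.

Lemma omega_knot a n k : a <= k < a + n%:Z -> (omega a n).[knot k] = 0.
Proof.
move=> kan; have kn : (absz (k - a) < n)%N by lia.
rewrite horner_prod (bigD1 (Ordinal kn)) //= !hornerE (_ : a + _ = k); last by lia.
by rewrite subrr mul0r.
Qed.

Lemma omega_neq0 a n t :
  (forall k, a <= k < a + n%:Z -> t != knot k) -> (omega a n).[t] != 0.
Proof.
move=> tn; rewrite horner_prod; apply/prodf_neq0 => i _.
by rewrite !hornerE subr_eq0 tn //; case: i => /= i; lia.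
Qed.

Section EndNodes.
Variables (Nm Np : int) (N : nat).
Hypothesis NE : Nm + Np = N%:Z.

Let sizeE : size (stencil Nm Np) = N.+1.
Proof. by rewrite size_stencil NE. Qed.

(** The increment, across the cell of [- Nm], of the product over all knots but the first;
    [last_coef] is its mirror image. Across every other cell of the stencil the product vanishes at
    both ends. *)
Definition first_coef : R := - (omega (- Nm + 1) N.+1).[knot (- Nm)].
Definition last_coef : R := (omega (- Nm) N.+1).[knot (Np + 1)].

Lemma first_coef_neq0 : first_coef != 0.
Proof.
by rewrite oppr_eq0 omega_neq0 // => k kN; rewrite eqr_knot; lia.
Qed.

Lemma last_coef_neq0 : last_coef != 0.
Proof. by rewrite omega_neq0 // => k kN; rewrite eqr_knot; lia. Qed.

Lemma deriv_omega_first :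
  (omega (- Nm + 1) N.+1)^`() = first_coef *: alphaR R Nm Np (- Nm).
Proof.
apply: deriv_step_alphaR; rewrite ?sizeE ?size_omega //.
  by rewrite mem_stencil; lia.
move=> k; rewrite mem_stencil -knotS -/(knot k) => kN.
rewrite omega_knot ?sub0r; last by lia.
case: eqVneq => [->|kNm]; first by rewrite mulr1.
by rewrite omega_knot ?oppr0 ?mulr0 //; lia.
Qed.

Lemma deriv_omega_last :
  (omega (- Nm) N.+1)^`() = last_coef *: alphaR R Nm Np Np.
Proof.
apply: deriv_step_alphaR; rewrite ?sizeE ?size_omega //.
  by rewrite mem_stencil; lia.
move=> k; rewrite mem_stencil -knotS -/(knot k) => kN.
rewrite [X in _ - X]omega_knot ?subr0; last by lia.
case: eqVneq => [->|kNm]; first by rewrite mulr1.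
by rewrite omega_knot ?mulr0 //; lia.
Qed.

Lemma omega_rolle a m n : a <= n -> n + 1 < a + m%:Z ->
  exists x, n%:~R - 2^-1 < x < n%:~R + 2^-1 /\ root (omega a m)^`() x.
Proof.
move=> an nm; rewrite -knotS -/(knot n).
have lt : knot n < knot (n + 1) by rewrite ltr_knot; lia.
have [|x] := @poly_rolle _ _ _ (omega a m) lt; first by rewrite !omega_knot //; lia.
by rewrite in_itv /= => xn rx; exists x; split=> //; apply/rootP.
Qed.

(** [xiR] falls back to 0 when there is no root, so existence comes first: Rolle between two
    consecutive zeros of [omega] supplies it. *)
Lemma xiR_first n : - Nm < n -> n <= Np ->
  [/\ knot n < xiR R Nm Np (- Nm) n, xiR R Nm Np (- Nm) n < knot (n + 1)
    & root (omega (- Nm + 1) N.+1)^`() (xiR R Nm Np (- Nm) n)].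
Proof.
move=> n1 n2; have [x] : exists x, n%:~R - 2^-1 < x < n%:~R + 2^-1 /\
    root (omega (- Nm + 1) N.+1)^`() x by apply: omega_rolle; lia.
rewrite deriv_omega_first knotS /knot !rootZ ?first_coef_neq0 // => xP.
by rewrite /xiR; case: xgetP => [y _ [/andP[]]|/(_ x xP)].
Qed.

Lemma xiR_last n : - Nm <= n -> n < Np ->
  [/\ knot n < xiR R Nm Np Np n, xiR R Nm Np Np n < knot (n + 1)
    & root (omega (- Nm) N.+1)^`() (xiR R Nm Np Np n)].
Proof.
move=> n1 n2; have [x] : exists x, n%:~R - 2^-1 < x < n%:~R + 2^-1 /\
    root (omega (- Nm) N.+1)^`() x by apply: omega_rolle; lia.
rewrite deriv_omega_last knotS /knot !rootZ ?last_coef_neq0 // => xP.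
by rewrite /xiR; case: xgetP => [y _ [/andP[]]|/(_ x xP)].
Qed.

End EndNodes.

(** * Signs of logarithmic derivatives between two knots *)

Definition logderiv a (n : nat) t : R :=
  \sum_(i < n) (t - knot (a + (i : nat)%:Z))^-1.

Lemma logderivSr a n t :
  logderiv a n.+1 t = logderiv a n t + (t - knot (a + n%:Z))^-1.
Proof. by rewrite /logderiv big_ord_recr. Qed.

Lemma logderivSl a n t :
  logderiv a n.+1 t = (t - knot a)^-1 + logderiv (a + 1) n t.
Proof.
rewrite /logderiv big_ord_recl addr0; congr (_ + _); apply: eq_bigr => i _.
by rewrite lift0 -addrA -intS.
Qed.

Lemma horner_deriv_omega a n t :
  (forall k, a <= k < a + n%:Z -> t != knot k) ->
  (omega a n)^`().[t] = (omega a n).[t] * logderiv a n t.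
Proof.
elim: n => [|n IH] tn.
  by rewrite /omega /logderiv !big_ord0 derivC mulr0 horner0.
rewrite omegaSr derivM derivXsubC !hornerE IH => [|k kn]; last by apply: tn; lia.
rewrite logderivSr.
have : t - knot (a + n%:Z) != 0 by rewrite subr_eq0 tn //; lia.
by move=> t0; field.
Qed.

(** No knot separates [s] from [t], so every summand decreases strictly. *)
Lemma logderiv_lt a n k s t : (0 < n)%N -> knot k < s -> s < t -> t < knot (k + 1) ->
  logderiv a n t < logderiv a n s.
Proof.
move=> n0 ks st tk; rewrite /logderiv; apply: ltr_sum.
  by apply/hasP; exists (Ordinal n0); rewrite ?mem_index_enum.
move=> i _; set j := a + _; have [jk|kj] := leP j k.
  have : knot j <= knot k by rewrite ler_knot.
  by move=> ?; rewrite ltf_pV2 ?posrE; lra.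
have : knot (k + 1) <= knot j by rewrite ler_knot; lia.
by move=> ?; rewrite ltf_nV2 ?negrE; lra.
Qed.

Lemma logderiv_root a n k t : (0 < n)%N -> knot k < t -> t < knot (k + 1) ->
  root (omega a n)^`() t -> logderiv a n t = 0.
Proof.
move=> n0 kt tk.
have tn j : t != knot j.
  apply/eqP => tj; move: kt tk; rewrite tj !ltr_knot; lia.
rewrite rootE horner_deriv_omega // mulf_eq0.
by rewrite (negbTE (omega_neq0 _)) //= => /eqP.
Qed.

(** Either the decreasing function still has a zero to the right of [t] in the same cell, or all
    knots lie to the left of [t]. The second case serves stencils ending at the point 1. *)
Lemma logderiv_gt0 a n k t : (0 < n)%N -> knot k < t -> t < knot (k + 1) ->
  (exists r, [/\ t < r, r < knot (k + 1) & root (omega a n)^`() r])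
    \/ a + n%:Z <= k + 1 ->
  0 < logderiv a n t.
Proof.
move=> n0 kt tk [[r [tr rk rt]]|an].
  by rewrite -(logderiv_root n0 (lt_trans kt tr) rk rt) (@logderiv_lt _ _ k).
rewrite /logderiv; case: n n0 an => // n _ an.
apply: (@lt_le_trans _ _ (t - knot (a + n%:Z))^-1).
  by rewrite invr_gt0 subr_gt0 (le_lt_trans _ kt) // ler_knot; lia.
rewrite big_ord_recr /= lerDr; apply: sumr_ge0 => i _.
rewrite invr_ge0 subr_ge0 ltW // (le_lt_trans _ kt) // ler_knot.
by case: i => /= i; lia.
Qed.

Lemma logderiv_lt0 a n k t : (0 < n)%N -> knot k < t -> t < knot (k + 1) ->
  (exists r, [/\ knot k < r, r < t & root (omega a n)^`() r]) \/ k < a ->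
  logderiv a n t < 0.
Proof.
move=> n0 kt tk [[r [kr rt rr]]|ka].
  by rewrite -(logderiv_root n0 kr (lt_trans rt tk) rr) (@logderiv_lt _ _ k).
rewrite /logderiv; case: n n0 => // n _.
apply: (@le_lt_trans _ _ (t - knot (a + n%:Z))^-1); last first.
  by rewrite invr_lt0 subr_lt0 (lt_le_trans tk) // ler_knot; lia.
rewrite big_ord_recr /= gerDr; apply: sumr_le0 => i _.
by rewrite invr_le0 subr_le0 ltW // (lt_le_trans tk) // ler_knot; case: i => /= i; lia.
Qed.

(** * One-level weights in closed form *)

(** On the nodes of the stencil [Nm], [Np'], [alphaI] of the stencil [Nm - 1], [Np] is wrong only at
    [- Nm]. The correcting constant does not depend on [Np'], so the full stencil and its left
    substencil share it. *)
Lemma alphaR_extend_left Nm Np Np' l :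
  Np - 1 <= Np' <= Np -> - Nm < l -> l <= Np' ->
  alphaR R Nm Np' l = alphaR R (Nm - 1) Np l
    - (alphaI R (Nm - 1) Np l).[(- Nm)%:~R] *: alphaR R Nm Np' (- Nm).
Proof.
move=> NpNp' Nml lNp'.
have l1 : l \in stencil Nm Np' by rewrite mem_stencil; lia.
have l2 : l \in stencil (Nm - 1) Np by rewrite mem_stencil; lia.
have l3 : - Nm \in stencil Nm Np' by rewrite mem_stencil; lia.
have s21 : (size (stencil (Nm - 1) Np) <= size (stencil Nm Np'))%N.
  by rewrite !size_stencil; lia.
pose B := size (stencil Nm Np').
rewrite -scaleNr !(alphaR_deconv (B := B)) //; try lia.
rewrite -deconvZ -deconvD; congr deconv.
apply: (stencil_interpolation (Nm := Nm) (Np := Np')).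
- exact: size_alphaI.
- rewrite (leq_trans (size_polyD _ _)) // geq_max (leq_trans (size_alphaI l2)) //=.
  exact: leq_trans (size_scale_leq _ _) (size_alphaI l3).
- move=> k ks; rewrite hornerD hornerZ !(alphaI_node _ ks).
  have [->|kNm] := eqVneq k (- Nm).
    by rewrite (lt_eqF Nml) mulr1 subrr.
  rewrite alphaI_node ?mulr0 ?addr0 //.
  by move: ks kNm; rewrite !mem_stencil; lia.
Qed.

Lemma sigma1_0 Nm Np t : sigma1 Nm Np 0 t =
  (alphaR R Nm Np (- Nm)).[t] / (alphaR R Nm (Np - 1) (- Nm)).[t].
Proof. by rewrite /sigma1; congr (_.[t] / _.[t]); congr alphaR; lia. Qed.

Lemma sigma1_1 Nm Np t : sigma1 Nm Np 1 t =
  (alphaR R Nm Np Np).[t] / (alphaR R (Nm - 1) Np Np).[t].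
Proof. by rewrite /sigma1; congr (_.[t] / _.[t]); congr alphaR; lia. Qed.

Section OneLevel.
Variables (Nm Np : int) (n : nat).
Hypothesis NE : Nm + Np = n.+2%:Z.

Let eta : {poly R} := omega (- Nm + 1) n.+2.

Let lastE : omega (- Nm + 1) n.+3 = eta * ('X - (knot (Np + 1))%:P).
Proof. by rewrite omegaSr (_ : - Nm + 1 + n.+2%:Z = Np + 1) //; lia. Qed.

Let firstE : omega (- Nm) n.+3 = ('X - (knot (- Nm))%:P) * eta.
Proof. exact: omegaSl. Qed.

Let widthE : knot (Np + 1) - knot (- Nm) = n.+3%:R :> R.
Proof. by rewrite /knot opprB addrA addrNK -intrB -[RHS]/(n.+3%:Z%:~R); congr _%:~R; lia. Qed.

Let sub0 : Nm + (Np - 1) = n.+1%:Z. Proof. by lia. Qed.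
Let sub1 : (Nm - 1) + Np = n.+1%:Z. Proof. by lia. Qed.

Let sub1E : - (Nm - 1) = - Nm + 1. Proof. by lia. Qed.

(** The denominator of the weight is a nonzero multiple of [eta'], so the hypothesis says that [t]
    is not a pole. The factor [n.+3%:R] is, up to sign, the ratio of the two normalising constants,
    namely the distance between the end knots. *)
Lemma sigma1_first t : eta^`().[t] != 0 ->
  sigma1 Nm Np 0 t =
  ((knot (Np + 1) - t) * eta^`().[t] - eta.[t]) / (n.+3%:R * eta^`().[t]).
Proof.
move=> e0; rewrite sigma1_0.
have := congr1 (horner^~ t) (deriv_omega_first NE).
have := congr1 (horner^~ t) (deriv_omega_first sub0).
have := first_coef_neq0 NE; have := first_coef_neq0 sub0.
rewrite /first_coef lastE -/eta derivM derivXsubC !hornerE.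
have -> : knot (- Nm) - knot (Np + 1) = - n.+3%:R :> R by rewrite -widthE [RHS]opprB.
set u := eta.[knot _]; set a := (alphaR _ Nm Np _).[t]; set b := (alphaR _ _ _ _).[t].
rewrite oppr_eq0 !mulrN opprK mulf_eq0 negb_or.
move: n.+3%:R => H u0 /andP[_ n0] E1 E2.
have aE : a = (eta^`().[t] * (t - knot (Np + 1)) + eta.[t]) / (u * H).
  by rewrite E2; field; rewrite u0 n0.
have b0 : b != 0 by apply: contra_neq e0 => b0; rewrite E1 b0 mulr0.
by rewrite aE E1; field; rewrite b0 n0 u0.
Qed.

Lemma sigma1_last t : eta^`().[t] != 0 ->
  sigma1 Nm Np 1 t =
  ((t - knot (- Nm)) * eta^`().[t] + eta.[t]) / (n.+3%:R * eta^`().[t]).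
Proof.
move=> e0; rewrite sigma1_1.
have := congr1 (horner^~ t) (deriv_omega_last NE).
have := congr1 (horner^~ t) (deriv_omega_last sub1).
have := last_coef_neq0 NE; have := last_coef_neq0 sub1.
rewrite /last_coef firstE sub1E -/eta derivM derivXsubC !hornerE widthE.
set u := eta.[knot _]; set a := (alphaR _ Nm Np _).[t]; set b := (alphaR _ _ _ _).[t].
rewrite mulf_eq0 negb_or.
move: n.+3%:R => H u0 /andP[n0 _] E1 E2.
have aE : a = (eta.[t] + (t - knot (- Nm)) * eta^`().[t]) / (u * H).
  by rewrite E2; field; rewrite u0 n0.
have b0 : b != 0 by apply: contra_neq e0 => b0; rewrite E1 b0 mulr0.
by rewrite aE E1; field; rewrite b0 n0 u0.
Qed.

Lemma sigma1_sum t : eta^`().[t] != 0 -> sigma1 Nm Np 0 t + sigma1 Nm Np 1 t = 1.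
Proof.
move=> e0; rewrite sigma1_first // sigma1_last // -mulrDl.
rewrite addrACA [- _ + _]addrC subrr addr0 -mulrDl addrA subrK widthE divff //.
by rewrite mulf_neq0 // pnatr_eq0.
Qed.

(** After eliminating the second weight and applying [alphaR_extend_left] twice, with the same
    constant, what remains is the quotient defining the first weight. *)
Lemma alphaR_convex_interior t l : eta^`().[t] != 0 -> - Nm < l -> l < Np ->
  (alphaR R Nm Np l).[t] =
  sigma1 Nm Np 0 t * (alphaR R Nm (Np - 1) l).[t]
  + sigma1 Nm Np 1 t * (alphaR R (Nm - 1) Np l).[t].
Proof.
move=> e0 l1 l2; have /eqP := sigma1_sum e0.
rewrite addrC eq_sym -subr_eq => /eqP <-; rewrite sigma1_0.
have d0 : (alphaR R Nm (Np - 1) (- Nm)).[t] != 0.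
  apply: contra_neq e0 => d0.
  by rewrite /eta (deriv_omega_first sub0) hornerZ d0 mulr0.
rewrite !(@alphaR_extend_left Nm Np _ l) //; try lia.
by rewrite !hornerE; field.
Qed.

End OneLevel.

(** * Positivity of the one-level weights *)

Lemma IC1_bounds Nm Np t : 0 <= Nm -> 1 <= Np -> IC1 Nm Np t ->
  [/\ xiR R Nm Np Np 0 < t, t < xiR R Nm Np (- Nm) 1,
      Nm = 0 \/ xiR R Nm (Np - 1) (- Nm) 0 < t &
      Np = 1 \/ t < xiR R (Nm - 1) Np Np 1].
Proof.
move=> Nm0 Np1; rewrite /IC1 /= in_itv /= /xi_minus /xi_plus.
case: eqVneq => [->|_]; case: eqVneq => [->|_]; rewrite ?gt_max ?lt_min.
- by move=> /andP[-> ->]; split; auto.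
- by move=> /and4P[-> -> _ ->]; split; auto.
- by move=> /andP[/and3P[-> _ ->] ->]; split; auto.
- by move=> /andP[/and3P[-> _ ->] /and3P[-> _ ->]]; split; auto.
Qed.

(** Distinct knots are simple roots. This serves the point $1/2$ itself, where logarithmic
    derivatives have a pole. *)
Lemma deriv_omega_knot_neq0 a n k : a <= k < a + n%:Z ->
  (omega a n)^`().[knot k] != 0.
Proof.
elim: n => [|n IH] kn; first lia.
rewrite omegaSr derivM derivXsubC !hornerE.
have [kE|kn'] := eqVneq k (a + n%:Z).
  rewrite kE subrr mulr0 add0r omega_neq0 // => j jn; rewrite eqr_knot; lia.
rewrite [X in _ + X]omega_knot ?addr0; last by lia.
by rewrite mulf_neq0 ?IH ?subr_eq0 ?eqr_knot //; lia.
Qed.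

Lemma neq_knot k t : knot k < t -> t < knot (k + 1) -> forall j, t != knot j.
Proof.
move=> kt tk j; apply: contraTneq tk => tE.
by rewrite -leNgt tE ler_knot; move: kt; rewrite tE ltr_knot; lia.
Qed.

Lemma sigma1_gt0 Nm Np n t : Nm + Np = n.+2%:Z ->
  0 <= Nm -> 1 <= Np -> IC1 Nm Np t ->
  [/\ (omega (- Nm + 1) n.+2)^`().[t] != 0,
      0 < sigma1 Nm Np 0 t & 0 < sigma1 Nm Np 1 t].
Proof.
move=> NE Nm0 Np1.
have leNm : - Nm <= 0 by lia.
have leNp : 2 <= Np + 1 by lia.
have lastE : - Nm + 1 + n.+2%:Z = Np + 1 by lia.
have sub1E : - Nm + 1 = - (Nm - 1) by lia.
have mid1 : - Nm + 1 <= 1 < - Nm + 1 + n.+2%:Z by lia.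
have Nm0P : Nm != 0 -> - Nm < 0 <= Np - 1 by lia.
have Np1P : Np != 1 -> - (Nm - 1) <= 1 < Np by lia.
move=> /(IC1_bounds Nm0 Np1)[b1 b2 b3 b4].
have sub0 : Nm + (Np - 1) = n.+1%:Z by lia.
have sub1 : (Nm - 1) + Np = n.+1%:Z by lia.
have [||_ r2k r2] := xiR_first NE (n := 1) _ _; [lia|lia|].
have [||kr1 _ r1] := xiR_last NE (n := 0) _ _; [lia|lia|].
have H0 : 0 < n.+3%:R :> R by rewrite ltr0n.
have tk0 : knot 0 < t by apply: lt_trans b1.
have tk2 : t < knot 2 by apply: lt_trans r2k.
have xf : 0 < t - knot (- Nm).
  by rewrite subr_gt0 (le_lt_trans _ tk0) // ler_knot.
have xl : t - knot (Np + 1) < 0.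
  by rewrite subr_lt0 (lt_le_trans tk2) // ler_knot.
have SrE : logderiv (- Nm + 1) n.+3 t =
    logderiv (- Nm + 1) n.+2 t + (t - knot (Np + 1))^-1.
  by rewrite logderivSr lastE.
have SlE : logderiv (- Nm) n.+3 t =
    (t - knot (- Nm))^-1 + logderiv (- Nm + 1) n.+2 t by exact: logderivSl.
(* Dividing by [eta] expresses both weights through $S=\eta'/\eta$. Their signs are those of
   $(S+1/(t-x_{last}))/S$ and $(S+1/(t-x_{first}))/S$. *)
have sigma1_logderiv (S := logderiv (- Nm + 1) n.+2 t) :
    (forall k, t != knot k) -> S != 0 ->
    [/\ (omega (- Nm + 1) n.+2)^`().[t] != 0,
      sigma1 Nm Np 0 t = (- (t - knot (Np + 1)) * S - 1) / (n.+3%:R * S) &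
      sigma1 Nm Np 1 t = ((t - knot (- Nm)) * S + 1) / (n.+3%:R * S)].
  move=> tn S0; have e0 : (omega (- Nm + 1) n.+2).[t] != 0 by exact: omega_neq0.
  have d0 : (omega (- Nm + 1) n.+2)^`().[t] != 0.
    by rewrite horner_deriv_omega // mulf_neq0.
  split=> //.
    rewrite (sigma1_first NE) // horner_deriv_omega // -/S.
    by move: n.+3%:R H0 => H H0; field; rewrite e0 S0 gt_eqF.
  rewrite (sigma1_last NE) // horner_deriv_omega // -/S.
  by move: n.+3%:R H0 => H H0; field; rewrite e0 S0 gt_eqF.
(* The bounds confine [t] to the two cells adjacent to [knot 1], which is $1/2$. On the left all the
   logarithmic derivatives involved are negative, on the right positive. *)
have [t1|t1|tE] := ltgtP t (knot 1).
- have tn := @neq_knot 0 _ tk0 t1.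
  have S0 : logderiv (- Nm + 1) n.+2 t < 0.
    apply: (logderiv_lt0 (k := 0)) => //; have [->|Nm1] := eqVneq Nm 0; first by right.
    left; case: b3 => [Nm00|b3]; first by rewrite Nm00 in Nm1.
    have /andP[? ?] := Nm0P Nm1; have [//|//|? ? ?] := xiR_first sub0 (n := 0) _ _.
    by exists (xiR R Nm (Np - 1) (- Nm) 0).
  have : logderiv (- Nm) n.+3 t < 0.
    by apply: (logderiv_lt0 (k := 0)) => //; left; exists (xiR R Nm Np Np 0).
  have [-> -> ->] := sigma1_logderiv tn (ltr0_neq0 S0).
  rewrite SlE => S1; split=> //.
    rewrite nmulr_rgt0 ?invr_lt0 ?pmulr_rlt0 //.
    by rewrite subr_lt0 (lt_trans _ ltr01) // pmulr_rlt0 ?oppr_gt0.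
  rewrite nmulr_rgt0 ?invr_lt0 ?pmulr_rlt0 //.
  have -> : (t - knot (- Nm)) * logderiv (- Nm + 1) n.+2 t + 1 =
      (t - knot (- Nm)) * ((t - knot (- Nm))^-1 + logderiv (- Nm + 1) n.+2 t).
    by rewrite mulrDr divff ?gt_eqF // addrC.
  by rewrite pmulr_rlt0.
- have tn := @neq_knot 1 _ t1 tk2.
  have S0 : 0 < logderiv (- Nm + 1) n.+2 t.
    apply: (logderiv_gt0 (k := 1)) => //; have [NpE|Np2] := eqVneq Np 1; first by right; rewrite lastE NpE.
    left; case: b4 => [Np11|b4]; first by rewrite Np11 in Np2.
    have /andP[? ?] := Np1P Np2; have [//|//|? ? ?] := xiR_last sub1 (n := 1) _ _.
    by exists (xiR R (Nm - 1) Np Np 1); rewrite sub1E.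
  have : 0 < logderiv (- Nm + 1) n.+3 t.
    by apply: (logderiv_gt0 (k := 1)) => //; left; exists (xiR R Nm Np (- Nm) 1).
  have [-> -> ->] := sigma1_logderiv tn (lt0r_neq0 S0).
  rewrite SrE => S1; split=> //.
    rewrite divr_gt0 ?mulr_gt0 //.
    have -> : - (t - knot (Np + 1)) * logderiv (- Nm + 1) n.+2 t - 1 =
      - (t - knot (Np + 1)) * (logderiv (- Nm + 1) n.+2 t + (t - knot (Np + 1))^-1).
      by rewrite mulrDr mulNr [X in _ = _ + X]mulNr divff ?lt_eqF.
    by rewrite mulr_gt0 ?oppr_gt0.
  by rewrite divr_gt0 ?mulr_gt0 // addr_gt0 ?mulr_gt0.
- have e0 : (omega (- Nm + 1) n.+2).[t] = 0 by rewrite tE omega_knot.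
  have d0 : (omega (- Nm + 1) n.+2)^`().[t] != 0.
    by rewrite tE deriv_omega_knot_neq0.
  (* At $t=1/2$ the terms in [eta] drop out, and each weight is the distance from [t] to an end knot
     over the total width. *)
  split=> //.
    rewrite (sigma1_first NE) // e0 subr0 -mulf_div divff // mulr1 divr_gt0 //.
    by rewrite -opprB oppr_gt0.
  by rewrite (sigma1_last NE) // e0 addr0 -mulf_div divff // mulr1 divr_gt0.
Qed.

(** * The one-level combination identity *)

(** The samples are abstracted to [g], which frees the identities from $x_i$ and $\Delta x$. *)
Definition reconstruct Nm Np (g : int -> R) t : R :=
  \sum_(l <- stencil Nm Np) (alphaR R Nm Np l).[t] * g l.

Lemma perm_stencil_first Nm Np : 0 <= Nm + Np ->
  perm_eq (stencil Nm Np) (- Nm :: stencil (Nm - 1) Np).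
Proof.
move=> N0; apply: uniq_perm; rewrite ?stencil_uniq //=.
  by rewrite stencil_uniq mem_stencil andbT; lia.
by move=> k; rewrite inE !mem_stencil; lia.
Qed.

Lemma perm_stencil_last Nm Np : 0 <= Nm + Np ->
  perm_eq (stencil Nm Np) (Np :: stencil Nm (Np - 1)).
Proof.
move=> N0; apply: uniq_perm; rewrite ?stencil_uniq //=.
  by rewrite stencil_uniq mem_stencil andbT; lia.
by move=> k; rewrite inE !mem_stencil; lia.
Qed.

(** Each end node lies in only one substencil, so its term is the defining quotient of a weight; the
    nodes in between are handled by [alphaR_convex_interior]. *)
Lemma reconstruct_one_level Nm Np n g t : Nm + Np = n.+2%:Z ->
  (omega (- Nm + 1) n.+2)^`().[t] != 0 ->
  reconstruct Nm Np g t =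
  sigma1 Nm Np 0 t * reconstruct Nm (Np - 1) g t + sigma1 Nm Np 1 t * reconstruct (Nm - 1) Np g t.
Proof.
move=> NE d0.
have sub0 : Nm + (Np - 1) = n.+1%:Z by lia.
have sub1 : (Nm - 1) + Np = n.+1%:Z by lia.
have a0 : (alphaR R Nm (Np - 1) (- Nm)).[t] != 0.
  apply: contra_neq d0 => a0.
  by rewrite (deriv_omega_first sub0) hornerZ a0 mulr0.
have a1 : (alphaR R (Nm - 1) Np Np).[t] != 0.
  apply: contra_neq d0 => a1; rewrite (_ : - Nm + 1 = - (Nm - 1)); last by lia.
  by rewrite (deriv_omega_last sub1) hornerZ a1 mulr0.
rewrite /reconstruct.
rewrite (perm_big _ (@perm_stencil_first Nm Np _)) /=; last by lia.
rewrite big_cons (perm_big _ (@perm_stencil_last (Nm - 1) Np _)) /=; last by lia.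
rewrite [X in sigma1 _ _ 0 _ * X](perm_big _ (@perm_stencil_first Nm (Np - 1) _)) /=; last by lia.
rewrite [X in sigma1 _ _ 1 _ * X](perm_big _ (@perm_stencil_last (Nm - 1) Np _)) /=; last by lia.
rewrite !big_cons.
have -> : \sum_(l <- stencil (Nm - 1) (Np - 1)) (alphaR R Nm Np l).[t] * g l =
  sigma1 Nm Np 0 t *
    (\sum_(l <- stencil (Nm - 1) (Np - 1)) (alphaR R Nm (Np - 1) l).[t] * g l) +
  sigma1 Nm Np 1 t *
    (\sum_(l <- stencil (Nm - 1) (Np - 1)) (alphaR R (Nm - 1) Np l).[t] * g l).
  rewrite !mulr_sumr -big_split; apply: eq_big_seq => l; rewrite mem_stencil => lN /=.
  by rewrite (alphaR_convex_interior NE d0); [ring|lia|lia].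
have -> : (alphaR R Nm Np (- Nm)).[t] = sigma1 Nm Np 0 t * (alphaR R Nm (Np - 1) (- Nm)).[t].
  by rewrite sigma1_0 divfK.
have -> : (alphaR R Nm Np Np).[t] = sigma1 Nm Np 1 t * (alphaR R (Nm - 1) Np Np).[t].
  by rewrite sigma1_1 divfK.
ring.
Qed.

Lemma sigma1_IC1 Nm Np t : 0 <= Nm -> 1 <= Np -> 2 <= Nm + Np -> IC1 Nm Np t ->
  [/\ 0 < sigma1 Nm Np 0 t, 0 < sigma1 Nm Np 1 t,
      sigma1 Nm Np 0 t + sigma1 Nm Np 1 t = 1 &
      forall g, reconstruct Nm Np g t = sigma1 Nm Np 0 t * reconstruct Nm (Np - 1) g t
                                 + sigma1 Nm Np 1 t * reconstruct (Nm - 1) Np g t].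
Proof.
move=> Nm0 Np1 N2.
have [n NE] : exists n : nat, Nm + Np = n.+2%:Z by exists (absz (Nm + Np)%R - 2)%N; lia.
move=> /(sigma1_gt0 NE Nm0 Np1)[d0 s0 s1]; split=> //; first exact: (sigma1_sum NE).
by move=> g; exact: (reconstruct_one_level _ NE).
Qed.

(** * Induction on the number of levels *)

Local Arguments sigma : simpl never.

(** A substencil has at most two parents, [k] and [k - 1]; the guards account for the two extreme
    ones, which have only one. *)
Lemma sigma_step Mm Mp K k t : (k <= K.+2)%N ->
  sigma Mm Mp K.+2 k t =
    (if (k <= K.+1)%N then
       sigma Mm Mp K.+1 k t * sigma1 (Mm - k%:Z) (Mp - K.+1%:Z + k%:Z) 0 t else 0)
  + (if k is k'.+1 then
       sigma Mm Mp K.+1 k' t * sigma1 (Mm - k'%:Z) (Mp - K.+1%:Z + k'%:Z) 1 t else 0).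
Proof.
move=> kK; rewrite sigma_rec // max0n !subn1 !succnK.
case: k kK => [|k] kK; first by rewrite minn0 big_nat1 [RHS]addr0.
rewrite ltnS in kK; rewrite succnK; case: ltnP => kK'.
  rewrite (minn_idPr _) // big_nat_recl // big_nat1 subSnn subnn addrC //.
have -> : k = K.+1 by apply/eqP; rewrite eqn_leq kK.
by rewrite (minn_idPl _) // big_nat1 subSnn [RHS]add0r.
Qed.

(** The same step seen from the parents. Taking [q] constant 1 gives the sum of the weights, taking
    it to be the substencil reconstructions gives the combination. *)
Lemma sigma_sum_step Mm Mp K t (q : nat -> R) :
  \sum_(k < K.+3) sigma Mm Mp K.+2 k t * q k =
  \sum_(s < K.+2) sigma Mm Mp K.+1 s t *
     (sigma1 (Mm - (s : nat)%:Z) (Mp - K.+1%:Z + (s : nat)%:Z) 0 t * q s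
      + sigma1 (Mm - (s : nat)%:Z) (Mp - K.+1%:Z + (s : nat)%:Z) 1 t * q s.+1).
Proof.
under eq_bigr => k _ do rewrite sigma_step -1?ltnS // mulrDl.
rewrite big_split /= big_ord_recr /= ltnn mul0r addr0.
rewrite [X in _ + X]big_ord_recl mul0r add0r -big_split; apply: eq_bigr => s _.
by rewrite lift0 /= ltn_ord -!mulrA -mulrDr.
Qed.

Lemma sigma_IC Mm Mp K t : 2 <= Mm + Mp -> K.+1%:Z <= Mm + 1 -> K.+1%:Z <= Mp ->
  IC Mm Mp K.+1 t ->
  [/\ forall k, (k <= K.+1)%N -> 0 < sigma Mm Mp K.+1 k t,
      \sum_(k < K.+2) sigma Mm Mp K.+1 k t = 1 &
      forall g, reconstruct Mm Mp g t = \sum_(k < K.+2) sigma Mm Mp K.+1 k t *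
        reconstruct (Mm - (k : nat)%:Z) (Mp - K.+1%:Z + (k : nat)%:Z) g t].
Proof.
move=> M2 KMm KMp tIC.
have one (L l : nat) : (l <= L)%N -> (L <= K)%N ->
    let Nm := Mm - l%:Z in let Np := Mp - L%:Z + l%:Z in
    [/\ 0 < sigma1 Nm Np 0 t, 0 < sigma1 Nm Np 1 t,
      sigma1 Nm Np 0 t + sigma1 Nm Np 1 t = 1 &
      forall g, reconstruct Nm Np g t = sigma1 Nm Np 0 t * reconstruct Nm (Np - 1) g t
                                 + sigma1 Nm Np 1 t * reconstruct (Nm - 1) Np g t].
  (* The substencil has total width at least 2: for $K=0$ by [M2], and for $K\geq1$ because the two
     bounds on $K$ give $M_-+M_+-L\geq K+1$. *)
  move=> lL LK; have := tIC L LK l lL; move: lL LK M2 KMm KMp; clear.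
  by move=> ? ? ? ? ?; apply: sigma1_IC1; lia.
elim: K KMm KMp one {tIC} => [|K IH] KMm KMp one.
  have [] := one 0%N 0%N isT isT; rewrite /= (subr0 Mm) (addr0 (Mp - 0%:Z)) (subr0 Mp) => s0 s1 s01 comb.
  split.
  - by move=> [|[|]].
  - by rewrite !big_ord_recl big_ord0 !sigma_1 [X in _ + X]addr0.
  - move=> g; rewrite comb !big_ord_recl big_ord0 !sigma_1 [X in _ = _ + X]addr0 lift0 /=.
    by congr (_ * reconstruct _ _ _ _ + _ * reconstruct _ _ _ _); lia.
have [||L l lL LK|s0 s1 comb] := IH; [lia|lia| |].
  by apply: one => //; exact: leqW.
split.
- move=> k kK; rewrite sigma_step //; case: k kK => [|k] kK /=.
    have [? ? _ _] := one K.+1 0%N (leq0n _) (leqnn _).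
    by rewrite addr0 mulr_gt0 // s0.
  have [_ ? _ _] := one K.+1 k kK (leqnn _).
  apply: ltr_wpDl; last by rewrite mulr_gt0 // s0.
  case: ifP => // kK'.
  have [? _ _ _] := one K.+1 k.+1 kK' (leqnn _).
  by rewrite mulr_ge0 // ltW // s0.
- under eq_bigr => k _ do rewrite -[sigma _ _ _ _ _]mulr1.
  rewrite (sigma_sum_step Mm Mp K t (fun=> 1)) -[RHS]s1; apply: eq_bigr => s _.
  have [_ _ s01 _] := one K.+1 s (leq_ord s) (leqnn _).
  by rewrite !mulr1 s01 mulr1.
- move=> g.
  rewrite (sigma_sum_step Mm Mp K t
    (fun k => reconstruct (Mm - k%:Z) (Mp - K.+2%:Z + k%:Z) g t)).
  rewrite comb; apply: eq_bigr => s _; congr (_ * _).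
  have [_ _ _ ->] := one K.+1 s (leq_ord s) (leqnn _).
  by congr (_ * reconstruct _ _ _ _ + _ * reconstruct _ _ _ _); lia.
Qed.

End Reconstruction.

Theorem theorem4p14 (R : realType) (Mm Mp : int) (Ks : nat)
    (hM : 2 <= Mm + Mp) (hMm : - Mm <= 0) (hMp : 1 <= Mp)
    (hKs1 : (1 <= Ks)%N) (hKs : Ks%:Z <= Num.min (Mm + 1) Mp) :
  forall t : R, IC Mm Mp Ks t ->
    (forall ks : nat, (ks <= Ks)%N -> 0 < sigma Mm Mp Ks ks t < 1) /\
    convex_weights Ks (fun ks => sigma Mm Mp Ks ks t) /\
    (forall (xi dx : R) (f : R -> R), 0 < dx ->
      pR Mm Mp (xi + t * dx) xi dx f =
      \sum_(ks < Ks.+1)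
        sigma Mm Mp Ks ks t *
        pR (Mm - (ks : nat)%:Z) (Mp - Ks%:Z + (ks : nat)%:Z)
           (xi + t * dx) xi dx f).
Proof.
move=> t tIC; case: Ks hKs1 hKs tIC => // K _; rewrite le_min => /andP[KMm KMp] tIC.
have [s0 s1 comb] := sigma_IC hM KMm KMp tIC.
have s01 k : (k <= K.+1)%N -> 0 < sigma Mm Mp K.+1 k t < 1.
  move=> kK; rewrite s0 //= -s1.
  pose i0 : 'I_K.+2 := Ordinal (n := K.+2) kK.
  rewrite (bigD1 i0) //= ltrDl.
  (* There are at least two weights, so another positive one keeps this one below the total 1. *)
  have [j ji] : exists j : 'I_K.+2, j != i0.
    by exists (if i0 == ord0 then ord_max else ord0); case: ifP => [/eqP ->|/negbT]; rewrite // eq_sym.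
  rewrite (bigD1 j) //= ltr_pwDl ?s0 ?leq_ord //.
  by apply: sumr_ge0 => i _; rewrite ltW // s0 // leq_ord.
split=> //; split; first by split=> // k /s01 /andP[/ltW -> /ltW ->].
move=> xi dx f dx0; rewrite pR_xi //.
rewrite -/(reconstruct Mm Mp (fun l => f (xi + l%:~R * dx)) t) comb.
by apply: eq_bigr => k _; rewrite pR_xi.
Qed.
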